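(* Let $S=\mathbb{Z}^n$, and let $\psi:\mathbb{R}^n\to\mathbb{R}$ be a minimal valid function for the continuous model. There exists a unique minimal lifting $\pi$ of $\psi$ if and only if $R_\psi+\mathbb{Z}^n=\mathbb{R}^n$.
   Context: Setting: $S=\mathbb{Z}^n$ and $f\in\mathbb{R}^n\setminus S$. The symbol $+$ between sets denotes Minkowski sum. Mixed model: triples $(x,s,y)$ with $x=f+\sum_{r\in\mathbb{R}^n} r s_r+\sum_{r\in\mathbb{R}^n} r y_r$, $x\in S$, $s_r\in\mathbb{R}_+$ and $y_r\in\mathbb{Z}_+$ for all $r\in\mathbb{R}^n$, where $s,y$ have finite support. Continuous model: pairs $(x,s)$ with $x=f+\sum_{r\in\mathbb{R}^n} r s_r$, $x\in S$, $s_r\in\mathbb{R}_+$ for all $r\in\mathbb{R}^n$, and $s$ of finite support. A function $\psi:\mathbb{R}^n\to\mathbb{R}$ is valid for the continuous model if $\sum_{r}\psi(r)s_r\ge 1$ for every $(x,s)$ in the continuous model. A pair $(\psi,\pi)$ of functions $\mathbb{R}^n\to\mathbb{R}$ is valid for the mixed model if $\sum_{r}\psi(r)s_r+\sum_r\pi(r)y_r\ge 1$ for every $(x,s,y)$ in the mixed model. A valid function (or pair) is minimal if there is no different valid function (or pair) that is pointwise less than or equal to it. If $\psi$ is valid for the continuous model, a lifting of $\psi$ is a function $\pi$ such that $(\psi,\pi)$ is valid for the mixed model. If $\psi$ is minimal valid for the continuous model, a minimal lifting of $\psi$ is a lifting $\pi$ such that $(\psi,\pi)$ is a minimal valid pair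 for the mixed model. For a minimal valid $\psi$: $R_\psi:=\{r\in\mathbb{R}^n : \pi(r)=\psi(r)\text{ for all minimal liftings }\pi\text{ of }\psi\}$. *)

(* Defs.v *)
(* R^n is the row-vector space over an abstract R : realType. *)
From HB Require Import structures.
From mathcomp Require Import all_boot all_order all_algebra.
From mathcomp Require Import finmap.
From mathcomp Require Import boolp classical_sets reals.

Set Implicit Arguments.
Unset Strict Implicit.
Unset Printing Implicit Defensive.

Import Order.TTheory GRing.Theory Num.Theory.

Local Open Scope classical_set_scope.
Local Open Scope ring_scope.

Definition integer_points (R : realType) (n : nat) : set 'rV[R]_n :=
  [set x | x \is a mxOver Num.int].

(* Finitely supported families s = (s_r) and y = (y_r) indexed by all r in R^n;
   a sum over all of R^n is the sum over [finsupp]. *)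
Definition real_family (R : realType) (n : nat) : Type :=
  {fsfun 'rV[R]_n -> R with 0}.

Definition nat_family (R : realType) (n : nat) : Type :=
  {fsfun 'rV[R]_n -> nat with 0%N}.

Definition continuous_model (R : realType) (n : nat) (f : 'rV[R]_n) :
    set ('rV[R]_n * real_family R n) :=
  [set p | let: (x, s) := p in
    [/\ x = f + \sum_(r <- finsupp s) s r *: r,
        integer_points x
      & forall r, 0 <= s r]].

Definition mixed_model (R : realType) (n : nat) (f : 'rV[R]_n) :
    set ('rV[R]_n * real_family R n * nat_family R n) :=
  [set p | let: (x, s, y) := p in
    [/\ x = f + \sum_(r <- finsupp s) s r *: r
              + \sum_(r <- finsupp y) r *+ y r,
        integer_points x
      & forall r, 0 <= s r]].

Definition valid_continuous (R : realType) (n : nat) (f : 'rV[R]_n)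
    (psi : 'rV[R]_n -> R) : Prop :=
  forall x s, continuous_model f (x, s) ->
    1 <= \sum_(r <- finsupp s) psi r * s r.

Definition valid_mixed (R : realType) (n : nat) (f : 'rV[R]_n)
    (psi pi : 'rV[R]_n -> R) : Prop :=
  forall x s y, mixed_model f (x, s, y) ->
    1 <= \sum_(r <- finsupp s) psi r * s r
         + \sum_(r <- finsupp y) pi r * (y r)%:R.

Definition minimal_continuous (R : realType) (n : nat) (f : 'rV[R]_n)
    (psi : 'rV[R]_n -> R) : Prop :=
  valid_continuous f psi /\
  forall psi', valid_continuous f psi' ->
    (forall r, psi' r <= psi r) -> psi' = psi.

Definition minimal_mixed (R : realType) (n : nat) (f : 'rV[R]_n)
    (psi pi : 'rV[R]_n -> R) : Prop :=
  valid_mixed f psi pi /\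
  forall psi' pi', valid_mixed f psi' pi' ->
    (forall r, psi' r <= psi r) -> (forall r, pi' r <= pi r) ->
    psi' = psi /\ pi' = pi.

Definition lifting (R : realType) (n : nat) (f : 'rV[R]_n)
    (psi pi : 'rV[R]_n -> R) : Prop :=
  valid_mixed f psi pi.

Definition minimal_lifting (R : realType) (n : nat) (f : 'rV[R]_n)
    (psi pi : 'rV[R]_n -> R) : Prop :=
  lifting f psi pi /\ minimal_mixed f psi pi.

Definition R_set (R : realType) (n : nat) (f : 'rV[R]_n)
    (psi : 'rV[R]_n -> R) : set 'rV[R]_n :=
  [set r | forall pi, minimal_lifting f psi pi -> pi r = psi r].

Definition minkowski_sum (R : realType) (n : nat) (A B : set 'rV[R]_n) :
    set 'rV[R]_n :=
  [set a + b | a in A & b in B].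

(* Main.v *)
(* Minimality makes [psi] sublinear, nonnegative, and bounded below by [1] on
   Z^n - f.  The vectors on which [psi] vanishes form a subspace, which by
   minimality contains every limit of lattice directions; this is what makes
   [phi r := min_(w in Z^n) psi (r + w)] attained.

   Minimal liftings are Z^n-periodic and, by Zorn's lemma, lie below every
   lifting.  Hence if R_psi + Z^n = R^n a minimal lifting is determined by its
   values [psi] on R_psi.

   Conversely a unique minimal lifting [pi] is the least lifting, so [pi r] is
   the least [a] with [k a + phi (- f - k r) >= 1] for all [k], and it remains
   to show [pi = phi].  Let [r' = - f - r].  If [pi r] and [pi r'] are
   positive, equality is attained above for some [k] at [r] and [j] at [r'].
   When [k = 1] or [j = 1], subadditivity gives [phi r = pi r].  Otherwise
   [pi r = pi r' = 1/2], [k = j = 2], and [phi (f + 2 r) = 0]; by continuity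
   the same would hold at all points near [r], forcing [phi (- f / k) = 0] for
   some [k], whereas [phi (- f) = 1]. *)
Require Import Defs.
From HB Require Import structures.
From mathcomp Require Import all_boot all_order all_algebra.
From mathcomp Require Import finmap.
From mathcomp Require Import boolp classical_sets reals.
From mathcomp Require Import topology normedtype.
From mathcomp Require Import lra zify.

Set Implicit Arguments.
Unset Strict Implicit.
Unset Printing Implicit Defensive.

Import Order.TTheory GRing.Theory Num.Theory.
Import numFieldNormedType.Exports.

Local Open Scope classical_set_scope.
Local Open Scope ring_scope.

(** * Finitely supported families rewritten as lists *)

Section FiniteFamilies.
Variables (R : realType) (n : nat).
Implicit Types (f x y : 'rV[R]_n) (psi pi : 'rV[R]_n -> R).

Lemma integer_pointsD x y :
  integer_points x -> integer_points y -> integer_points (x + y).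
Proof.
move=> /mxOverP hx /mxOverP hy; apply/mxOverP => i j.
by rewrite mxE rpredD.
Qed.

Lemma integer_pointsN x : integer_points x -> integer_points (- x).
Proof. by move=> /mxOverP hx; apply/mxOverP => i j; rewrite mxE rpredN. Qed.

Lemma integer_points0 : integer_points (0 : 'rV[R]_n).
Proof. by apply/mxOverP => i j; rewrite mxE rpred0. Qed.

Lemma integer_pointsMn x k : integer_points x -> integer_points (x *+ k).
Proof.
move=> hx; elim: k => [|k IH]; first exact: integer_points0.
by rewrite mulrS; apply: integer_pointsD.
Qed.

Lemma big_fset_pred1 (V : nmodType) (S : {fset 'rV[R]_n}) q
    (F : 'rV[R]_n -> V) :
  q \in S -> \sum_(r <- S | q == r) F r = F q.
Proof.
move=> qS; rewrite -big_filter.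
have -> : [seq i <- S | q == i] = [:: q].
  by under eq_filter do rewrite eq_sym; exact: filter_pred1_uniq.
by rewrite big_seq1.
Qed.

(** Coefficients attached to repeated vectors are added up. Quantifying over [V] and [G] lets one
    [s] serve both for the vector sum and for the sum of function values. *)
Lemma real_family_of_seq (l : seq (R * 'rV[R]_n)) :
  all (fun p => 0 <= p.1) l ->
  exists s : real_family R n, (forall r, 0 <= s r) /\
    forall (V : lmodType R) (G : 'rV[R]_n -> V),
      \sum_(r <- finsupp s) s r *: G r = \sum_(p <- l) p.1 *: G p.2.
Proof.
move=> /allP l0.
pose c (r : 'rV[R]_n) := \sum_(p <- l | p.2 == r) p.1.
pose S := [fset p.2 | p in l]%fset.
pose s : real_family R n := [fsfun r in S => c r].
exists s; split.
  move=> r; rewrite fsfunE; case: ifP => // _.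
  by rewrite /c big_seq_cond; apply: sumr_ge0 => p /andP[/l0].
move=> V G.
have sS : (finsupp s `<=` S)%fset by exact: finsupp_sub.
rewrite (big_fset_incl _ sS); last first.
  by move=> r _; rewrite mem_finsupp negbK => /eqP ->; rewrite scale0r.
under eq_big_seq => r rS do
  rewrite fsfunE rS /c scaler_suml big_mkcond.
rewrite exchange_big /=; apply: eq_big_seq => p pl.
have pS : p.2 \in S by apply/imfsetP; exists p.
by rewrite -big_mkcond /= big_fset_pred1.
Qed.

Lemma nat_family_of_seq (l : seq 'rV[R]_n) :
  exists y : nat_family R n,
    forall (V : zmodType) (G : 'rV[R]_n -> V),
      \sum_(r <- finsupp y) G r *+ y r = \sum_(r <- l) G r.
Proof.
pose S := [fset r in l]%fset.
pose y : nat_family R n := [fsfun r in S => count_mem r l].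
exists y => V G.
have yS : (finsupp y `<=` S)%fset by exact: finsupp_sub.
rewrite (big_fset_incl _ yS); last first.
  by move=> r _; rewrite mem_finsupp negbK => /eqP ->.
rewrite (eq_big_seq (fun r => \sum_(q <- l | q == r) G q)); last first.
  move=> r rS; rewrite fsfunE rS.
  rewrite (eq_bigr (fun=> G r)) => [|q /eqP -> //].
  by rewrite big_const_seq iter_addr_0.
under eq_bigr do rewrite big_mkcond; rewrite exchange_big /=.
apply: eq_big_seq => q ql.
have qS : q \in S by rewrite inE.
by rewrite -big_mkcond /= big_fset_pred1.
Qed.

Lemma seq_of_nat_family (y : nat_family R n) :
  exists l : seq 'rV[R]_n,
    forall (V : zmodType) (G : 'rV[R]_n -> V),
      \sum_(r <- finsupp y) G r *+ y r = \sum_(r <- l) G r.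
Proof.
exists (flatten [seq nseq (y r) r | r <- finsupp y]) => V G.
rewrite big_flatten big_map; apply: eq_bigr => r _.
by rewrite big_nseq iter_addr_0.
Qed.

(** Lists, unlike families with a support, can be concatenated and substituted into each other
    without merging equal vectors. *)
Lemma valid_continuousP f psi :
  valid_continuous f psi <->
  forall l : seq (R * 'rV[R]_n), all (fun p => 0 <= p.1) l ->
    integer_points (f + \sum_(p <- l) p.1 *: p.2) ->
    1 <= \sum_(p <- l) p.1 * psi p.2.
Proof.
split=> [hv l l0 lint | hv x s [xE xint s0]].
  have [s [s0 sE]] := real_family_of_seq l0.
  have <- : \sum_(r <- finsupp s) psi r * s r = \sum_(p <- l) p.1 * psi p.2.
    by rewrite -(sE R^o psi); apply: eq_bigr => r _; rewrite mulrC.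
  apply: hv; split; [exact: erefl | | exact: s0].
  by rewrite (sE _ id).
pose l := [seq (s r, r) | r <- finsupp s].
have -> : \sum_(r <- finsupp s) psi r * s r = \sum_(p <- l) p.1 * psi p.2.
  by rewrite big_map; apply: eq_bigr => r _; rewrite mulrC.
apply: hv; first by apply/allP => _ /mapP[r _ ->] /=.
by rewrite big_map /= -xE.
Qed.

Lemma valid_mixedP f psi pi :
  valid_mixed f psi pi <->
  forall (l : seq (R * 'rV[R]_n)) (m : seq 'rV[R]_n),
    all (fun p => 0 <= p.1) l ->
    integer_points (f + \sum_(p <- l) p.1 *: p.2 + \sum_(r <- m) r) ->
    1 <= \sum_(p <- l) p.1 * psi p.2 + \sum_(r <- m) pi r.
Proof.
split=> [hv l m l0 lint | hv x s y [xE xint s0]].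
  have [s [s0 sE]] := real_family_of_seq l0.
  have [y yE] := nat_family_of_seq m.
  have <- : \sum_(r <- finsupp s) psi r * s r = \sum_(p <- l) p.1 * psi p.2.
    by rewrite -(sE R^o psi); apply: eq_bigr => r _; rewrite mulrC.
  have <- : \sum_(r <- finsupp y) pi r * (y r)%:R = \sum_(r <- m) pi r.
    by rewrite -yE; apply: eq_bigr => r _; rewrite mulr_natr.
  apply: hv; split; [exact: erefl | | exact: s0].
  by rewrite (sE _ id) (yE _ id).
have [m mE] := seq_of_nat_family y.
pose l := [seq (s r, r) | r <- finsupp s].
have -> : \sum_(r <- finsupp s) psi r * s r = \sum_(p <- l) p.1 * psi p.2.
  by rewrite big_map; apply: eq_bigr => r _; rewrite mulrC.
have -> : \sum_(r <- finsupp y) pi r * (y r)%:R = \sum_(r <- m) pi r.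
  by rewrite -mE; apply: eq_bigr => r _; rewrite mulr_natr.
apply: hv; first by apply/allP => _ /mapP[r _ ->] /=.
by rewrite big_map /= -mE -xE.
Qed.

End FiniteFamilies.

(** * Sublinearity of minimal valid functions *)

Section Sublinear.
Variables (R : realType) (n : nat) (f : 'rV[R]_n) (psi : 'rV[R]_n -> R).
Hypothesis hpsi : minimal_continuous f psi.

Lemma minimal_continuous_at r0 v :
  valid_continuous f (fun r => if r == r0 then v else psi r) -> psi r0 <= v.
Proof.
move=> hv; rewrite leNgt; apply/negP => lt_v.
have le_psi r : (if r == r0 then v else psi r) <= psi r.
  by case: eqP => // ->; exact: ltW.
have /(congr1 (fun h => h r0)) := hpsi.2 _ hv le_psi.
by rewrite eqxx => vE; rewrite vE ltxx in lt_v.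
Qed.

(** Lowering the value at [r0] to [v] keeps validity: every use of [r0] in a feasible combination
    can be replaced by a scaled copy of [l], at the same cost. *)
Lemma psi_conic (l : seq (R * 'rV[R]_n)) : all (fun p => 0 <= p.1) l ->
  psi (\sum_(p <- l) p.1 *: p.2) <= \sum_(p <- l) p.1 * psi p.2.
Proof.
move=> /allP l0; set r0 := \sum_(p <- l) _; set v := \sum_(p <- l) _.
apply: minimal_continuous_at; apply/valid_continuousP => m /allP m0 mint.
pose g (p : R * 'rV[R]_n) :=
  if p.2 == r0 then [seq (p.1 * q.1, q.2) | q <- l] else [:: p].
have := (valid_continuousP f psi).1 hpsi.1 (flatten [seq g p | p <- m]).
rewrite !big_flatten !big_map => hv.
have -> : \sum_(p <- m) p.1 * (if p.2 == r0 then v else psi p.2)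
   = \sum_(p <- m) \sum_(q <- g p) q.1 * psi q.2.
  apply: eq_bigr => p _; rewrite /g; case: eqP => _; last by rewrite big_seq1.
  by rewrite big_map mulr_sumr; apply: eq_bigr => q _; rewrite /= mulrA.
apply: hv.
  apply/allP => q /flattenP[_ /mapP[p pm ->]]; rewrite /g.
  case: eqP => _; last by rewrite inE => /eqP ->; exact: m0.
  by case/mapP => q' q'l -> /=; apply: mulr_ge0; [exact: m0 | exact: l0].
suff -> : \sum_(p <- m) \sum_(q <- g p) q.1 *: q.2 = \sum_(p <- m) p.1 *: p.2.
  by [].
apply: eq_bigr => p _; rewrite /g; case: eqP => [->|_]; last by rewrite big_seq1.
by rewrite big_map scaler_sumr; apply: eq_bigr => q _; rewrite /= scalerA.
Qed.

Lemma psiD x y : psi (x + y) <= psi x + psi y.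
Proof.
have := @psi_conic [:: (1, x); (1, y)].
by rewrite !big_cons !big_nil /= !scale1r !mul1r !addr0 ler01; apply.
Qed.

Lemma psi0 : psi 0 = 0.
Proof.
apply/eqP; rewrite eq_le; apply/andP; split.
  by have := @psi_conic [::] isT; rewrite !big_nil.
by have := psiD 0 0; rewrite add0r lerDl.
Qed.

Lemma psiZ c x : 0 <= c -> psi (c *: x) = c * psi x.
Proof.
have le_psi d y : 0 <= d -> psi (d *: y) <= d * psi y.
  move=> d0; have := @psi_conic [:: (d, y)].
  by rewrite !big_cons !big_nil /= !addr0 d0; apply.
rewrite le_eqVlt => /predU1P[<-|c0]; first by rewrite scale0r psi0 mul0r.
apply/eqP; rewrite eq_le le_psi ?(ltW c0) //= -ler_pdivlMl //.
have := le_psi c^-1 (c *: x).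
by rewrite scalerA mulVf ?gt_eqF // scale1r; apply; rewrite invr_ge0 ltW.
Qed.

Lemma psi_ge1 w : integer_points w -> 1 <= psi (w - f).
Proof.
move=> wint; have := (valid_continuousP f psi).1 hpsi.1 [:: (1, w - f)].
rewrite !big_seq1 /= mul1r scale1r ler01 addrC subrK; exact.
Qed.

Lemma psi_sub x y : psi x - psi y <= psi (x - y).
Proof. by rewrite lerBlDr (le_trans _ (psiD _ _)) // subrK. Qed.

Lemma psi_sum (I : Type) (s : seq I) (F : I -> 'rV[R]_n) :
  psi (\sum_(i <- s) F i) <= \sum_(i <- s) psi (F i).
Proof.
elim: s => [|i s IH]; first by rewrite !big_nil psi0.
by rewrite !big_cons (le_trans (psiD _ _)) // lerD2l.
Qed.

(** By sublinearity the cheapest continuous part is a single ray, the one that leads from the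
    integer part of the sum to the lattice point [w]. *)
Lemma liftingP pi :
  lifting f psi pi <->
  forall (m : seq 'rV[R]_n) w, integer_points w ->
    1 <= psi (w - f - \sum_(r <- m) r) + \sum_(r <- m) pi r.
Proof.
split=> [/valid_mixedP hv m w wint | hv]; last first.
  apply/valid_mixedP => l m l0 lint; have := hv m _ lint => /le_trans; apply.
  rewrite lerD2r (addrAC _ (- f)) addrK addrAC subrr add0r; exact: psi_conic.
have := hv [:: (1, w - f - \sum_(r <- m) r)] m.
rewrite !big_seq1 /= mul1r scale1r ler01; apply=> //.
by rewrite -addrA subrK addrC subrK.
Qed.

End Sublinear.

(** * Compactness and simultaneous Diophantine approximation *)

Section RowVectors.
Variables (R : realType) (n : nat).
Implicit Types (v w x : 'rV[R]_n).

Lemma coord_le_norm x j : `|x 0 j| <= `|x|.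
Proof.
rewrite [leRHS]/Num.Def.normr /= mx_normrE.
by apply/bigmax_geP; right => /=; exists (0, j).
Qed.

Lemma norm_le_coord x b : 0 <= b -> (forall j, `|x 0 j| <= b) -> `|x| <= b.
Proof.
move=> b0 xb; rewrite [leLHS]/Num.Def.normr /= mx_normrE.
by apply: bigmax_le => //= -[i j] _ /=; rewrite ord1; exact: xb.
Qed.

Lemma bounded_seq_cluster (u : nat -> 'rV[R]_n) b : (forall k, `|u k| <= b) ->
  exists v, forall e, 0 < e -> forall K, exists2 k, (K <= k)%N & `|u k - v| < e.
Proof.
move=> ub; pose A := [set x : 'rV[R]_n | `|x| <= b].
have Abnd : bounded_set A.
  exists b; split; first exact: num_real.
  by move=> c bc x /= /le_trans; apply; exact: ltW.
have Acl : closed A.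
  apply: (@closed_comp _ _ (fun x : 'rV[R]_n => `|x|) [set t | t <= b]).
    by move=> x _; exact: norm_continuous.
  exact: closed_le.
have Acpt := bounded_closed_compact Abnd Acl.
have [|v [_ vu]] := Acpt (u @ \oo) _.
  by exists 0%N => // k _ /=; exact: ub.
exists v => e e0 K.
have [||x [[k /= Kk <-] vk]] := vu [set u k | k in [set k | (K <= k)%N]] (ball v e).
- by exists K => // k /= Kk; exists k.
- exact: nbhsx_ballx.
exists k => //; rewrite distrC; move: vk.
by rewrite -ball_normE.
Qed.

Lemma dirichlet_approximation v e (T : nat) : 0 < e ->
  exists2 m, (T <= m)%N & exists2 w, integer_points w & `|m%:R *: v - w| < e.
Proof.
move=> e0.
pose z k := (\row_j (Num.floor ((k%:R *: v) 0 j))%:~R : 'rV[R]_n).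
(* [u k] below is the vector of fractional parts of [k v]. Two of them close to a common cluster
   point, with indices at least [T] apart, give the approximation. *)
have zint k : integer_points (z k).
  by apply/mxOverP => i j; rewrite mxE intr_int.
pose u k := k%:R *: v - z k.
have [|x xu] := @bounded_seq_cluster u 1.
  move=> k; apply: norm_le_coord => // j; rewrite !mxE.
  have /andP[] := Num.Theory.floor_itv (k%:R * v 0 j).
  rewrite intrD ler_norml; lra.
have e20 : 0 < e / 2 by rewrite divr_gt0.
have [i _ xi] := xu _ e20 0%N.
have [j ij xj] := xu _ e20 (i + T)%N.
exists (j - i)%N; first by lia.
exists (z j - z i).
  by apply: integer_pointsD => //; exact: integer_pointsN.
have -> : (j - i)%N%:R *: v - (z j - z i) = (u j - x) - (u i - x).
  rewrite /u natrB; last by lia.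
  by rewrite scalerBl !opprB subrKA addrACA [RHS]addrACA (addrC (- z j)).
by rewrite (splitr e) (le_lt_trans (ler_normB _ _)) // ltrD.
Qed.

End RowVectors.

(** * The null space of [psi] and coercivity modulo it *)

Section Recession.
Variables (R : realType) (n : nat) (f : 'rV[R]_n) (psi : 'rV[R]_n -> R).
Hypothesis hpsi : minimal_continuous f psi.
Let psiD := psiD hpsi.
Let psi0 := psi0 hpsi.
Let psiZ := psiZ hpsi.

Lemma psi_norm_bound : exists2 C, 0 < C & forall x, psi x <= C * `|x|.
Proof.
pose a j := `|psi (delta_mx 0 j)| + `|psi (- delta_mx 0 j)|.
have a0 j : 0 <= a j by rewrite addr_ge0.
exists (1 + \sum_j a j) => [|x].
  by rewrite ltr_pwDl // sumr_ge0.
rewrite mulrDl mul1r ler_wpDl //.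
rewrite {1}[x]row_sum_delta (le_trans (psi_sum hpsi _ _)) // mulr_suml.
apply: ler_sum => j _; apply: (@le_trans _ _ (a j * `|x 0 j|)); last first.
  by rewrite ler_wpM2l // coord_le_norm.
rewrite mulrC; have [xj|xj] := leP 0 (x 0 j).
  rewrite psiZ // ger0_norm // ler_wpM2l // /a.
  by rewrite (le_trans (ler_norm _)) // lerDl.
rewrite -[x 0 j]opprK scaleNr -scalerN psiZ ?oppr_ge0 ?(ltW xj) //.
rewrite normrN (ger0_norm (_ : 0 <= - _)) ?oppr_ge0 ?(ltW xj) //.
rewrite ler_wpM2l ?oppr_ge0 ?(ltW xj) // /a.
by rewrite (le_trans (ler_norm _)) // lerDr.
Qed.

(** The infimum of [psi] over the lattice translates of [x] is at most zero; an infimum is used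
    because attainment is only established later. *)
Definition almost_null x :=
  forall e, 0 < e -> exists2 w, integer_points w & psi (x + w) < e.

Lemma almost_null_closed y :
  (forall e, 0 < e -> exists2 x, almost_null x & psi (y - x) < e) ->
  almost_null y.
Proof.
move=> hy e e0; have e20 : 0 < e / 2 by rewrite divr_gt0.
have [x hx yx] := hy _ e20; have [w wint xw] := hx _ e20.
exists w => //; rewrite (splitr e) -[y](subrK x) -addrA.
by rewrite (le_lt_trans (psiD _ _)) // ltrD.
Qed.

(* Shifting by [s *: v] and an integer vector costs nothing, so lowering
   [psi v] to [0] preserves validity. *)
Lemma psi_le0_of_almost_null_ray v :
  (forall s, 0 <= s -> almost_null (s *: v)) -> psi v <= 0.
Proof.
move=> hv; apply: (minimal_continuous_at hpsi).
apply/valid_continuousP => l /allP l0 lint.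
pose s := \sum_(p <- l | p.2 == v) p.1.
pose l' := [seq p <- l | p.2 != v].
have -> : \sum_(p <- l) p.1 * (if p.2 == v then 0 else psi p.2) =
  \sum_(p <- l') p.1 * psi p.2.
  rewrite big_filter [RHS]big_mkcond /=; apply: eq_bigr => p _.
  by case: eqP => //=; rewrite mulr0.
have s0 : 0 <= s by rewrite /s big_seq_cond sumr_ge0 // => p /andP[/l0].
have lE : \sum_(p <- l) p.1 *: p.2 = s *: v + \sum_(p <- l') p.1 *: p.2.
  rewrite (bigID (fun p => p.2 == v)) /= big_filter scaler_suml; congr (_ + _).
  by apply: eq_bigr => p /eqP ->.
apply/ler_addgt0Pr => e e0.
have [w wint wlt] := hv s s0 e e0.
have := psi_ge1 hpsi (integer_pointsD lint wint).
rewrite lE => /le_trans; apply.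
have -> : f + (s *: v + \sum_(p <- l') p.1 *: p.2) + w - f
   = \sum_(p <- l') p.1 *: p.2 + (s *: v + w).
  by rewrite addrAC [f + _]addrC addrK [s *: v + _]addrC -addrA.
rewrite (le_trans (psiD _ _)) // lerD ?(ltW wlt) //.
apply: (psi_conic hpsi); apply/allP => p; rewrite mem_filter => /andP[_].
exact: l0.
Qed.

(* The line through [v] comes back arbitrarily close to the lattice. *)
Lemma psi_opp_le0 v : psi v <= 0 -> psi (- v) <= 0.
Proof.
move=> v0; apply: psi_le0_of_almost_null_ray => s s0 e e0.
have [C C0 hC] := psi_norm_bound.
have [m sm [w wint wlt]] :=
  dirichlet_approximation v (Num.truncn s).+1 (divr_gt0 e0 C0).
have {}sm : s <= m%:R.
  apply: ltW; apply: lt_le_trans (truncnS_gt _) _; by rewrite ler_nat.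
exists w => //.
(* Since [m >= s], the first term is a nonnegative multiple of [v] and costs at most zero; the
   second is small in norm. *)
have -> : s *: - v + w = (m%:R - s) *: v + (w - m%:R *: v).
  by rewrite scalerBl scalerN [_ - s *: v]addrC addrACA subrr addr0.
apply: le_lt_trans (psiD _ _) _; rewrite psiZ ?subr_ge0 //.
rewrite -[e]add0r ler_ltD //; first by rewrite mulr_ge0_le0 ?subr_ge0.
by rewrite (le_lt_trans (hC _)) // distrC mulrC -ltr_pdivlMr.
Qed.

Lemma psi_ge0 v : 0 <= psi v.
Proof.
have [v0|/ltW //] := leP (psi v) 0.
have := psi_opp_le0 v0; have := psiD v (- v).
by rewrite subrr psi0; lra.
Qed.

Lemma psi_shift x l : psi l <= 0 -> psi (x + l) = psi x.
Proof.
move=> l0; have := psi_opp_le0 l0; have := psiD x l.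
by have := psiD (x + l) (- l); rewrite addrK; lra.
Qed.

(** The factor 2 spares proving that the distance to the null space is attained. If that distance is
    zero, [x] itself is null by the norm bound. *)
Lemma reduced_representative x : exists2 l, psi l <= 0 &
  forall l', psi l' <= 0 -> `|x + l| <= 2 * `|x + l'|.
Proof.
have [C C0 hC] := psi_norm_bound.
pose E := [set `|x + l| | l in [set l | psi l <= 0]].
have hE : has_inf E.
  split; first by exists `|x + 0|; exists 0 => //=; rewrite psi0.
  by exists 0 => _ [l _ <-].
have [E0|E0] := ltP 0 (inf E).
  have [_ [l l0 <-] ltl] := inf_adherent E0 hE.
  exists l => // l' l'0; apply: le_trans (ltW ltl) _.
  suff : inf E <= `|x + l'| by lra.
  by apply: ge_inf; [exact: hE.2 | exists l'].
have x0 : psi x <= 0.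
  apply/ler_addgt0Pr => e e0; rewrite add0r.
  have [_ [l /= l0 <-] ltl] := inf_adherent (divr_gt0 e0 C0) hE.
  rewrite -(psi_shift x l0) (le_trans (hC _)) // mulrC -ler_pdivlMr //.
  by apply: ltW; apply: lt_le_trans ltl _; rewrite gerDr.
exists (- x); first exact: psi_opp_le0.
by move=> l' _; rewrite subrr normr0 mulr_ge0.
Qed.

(** Otherwise there are reduced unit vectors [u k] with [psi (u k)] tending to 0. A cluster point
    [v] is null, so reducedness gives [1 <= 2 * |u k - v|], which fails for [u k] close to [v]. *)
Lemma psi_coercive : exists2 c, 0 < c &
  forall x, exists2 l, psi l <= 0 & `|x + l| <= c * psi x.
Proof.
have [C C0 hC] := psi_norm_bound.
apply: contrapT => nc.
pose red u := forall l, psi l <= 0 -> `|u| <= 2 * `|u + l|.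
have hu k : exists u, [/\ `|u| = 1, red u & psi u < k.+1%:R^-1].
  apply: contrapT => nu; apply: nc; exists k.+1%:R => // x.
  have [l l0 lmin] := reduced_representative x; exists l => //.
  rewrite leNgt; apply/negP => ltx; apply: nu.
  have xl0 : 0 < `|x + l|.
    by apply: le_lt_trans ltx; rewrite mulr_ge0 // psi_ge0.
  exists (`|x + l|^-1 *: (x + l)); split.
  - by rewrite normrZ gtr0_norm ?invr_gt0 // mulVf // gt_eqF.
  - move=> l' l'0.
    have -> : l' = `|x + l|^-1 *: (`|x + l| *: l').
      by rewrite scalerA mulVf ?scale1r // gt_eqF.
    rewrite -scalerDr !normrZ mulrCA ler_wpM2l // -addrA; apply: lmin.
    rewrite addrC psi_shift // psiZ // pmulr_rle0 //.
  - rewrite psiZ ?invr_ge0 // psi_shift // ltr_pdivrMl // ltr_pdivlMr //.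
    by rewrite mulrC.
have {hu}[u hu] := choice hu.
have [v hv] := @bounded_seq_cluster _ _ u 1 (fun k => ltac:(by have [-> _ _] := hu k)).
have v0 : psi v <= 0.
  apply/ler_addgt0Pr => e e0; rewrite add0r.
  have e20 : 0 < e / 2 by rewrite divr_gt0.
  have [k hk kv] := hv _ (divr_gt0 e20 C0) (Num.truncn (e / 2)^-1).
  have [_ _ uk] := hu k.
  have ke : k.+1%:R^-1 <= e / 2.
    rewrite -[leRHS]invrK lef_pV2 ?posrE ?invr_gt0 //.
    by apply: ltW; apply: lt_le_trans (truncnS_gt _) _; rewrite ler_nat.
  rewrite -[v](subrK (u k)) (le_trans (psiD _ _)) // (splitr e) lerD //.
    rewrite (le_trans (hC _)) // distrC mulrC -ler_pdivlMr //; exact: ltW.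
  exact: le_trans (ltW uk) ke.
have [k _ kv] := hv (1 / 2) ltac:(by rewrite divr_gt0) 0%N.
have [u1 ured _] := hu k.
by have := ured _ (psi_opp_le0 v0); rewrite u1; lra.
Qed.

End Recession.

(** * Attainment of the minimum over lattice translates *)

Section Attainment.
Variables (R : realType) (n : nat) (f : 'rV[R]_n) (psi : 'rV[R]_n -> R).
Hypothesis hpsi : minimal_continuous f psi.

Lemma almost_null_lattice d z (m : nat) :
  integer_points z -> psi (d - z) <= 0 -> almost_null psi (m%:R *: d).
Proof.
move=> zint dz e e0; exists (- (z *+ m)).
  by apply: integer_pointsN; exact: integer_pointsMn.
apply: le_lt_trans e0.
by rewrite scaler_nat -mulrnBl -scaler_nat (psiZ hpsi) // mulr_ge0_le0.
Qed.

(* Along a limit direction [v] of such [d / psi d] the multiples of the [d]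
   are dense, so the whole ray is almost null although [psi v = 1]. *)
Lemma psi_lattice_gap : exists2 e, 0 < e &
  forall d z, integer_points z -> psi (d - z) <= 0 -> 0 < psi d -> e <= psi d.
Proof.
have [C C0 hC] := psi_norm_bound hpsi.
have [c c0 hc] := psi_coercive hpsi.
apply: contrapT => ne.
have hu k : exists u, [/\ `|u| <= c, psi u = 1 & exists d,
    [/\ forall m : nat, almost_null psi (m%:R *: d),
        0 < psi d, psi d < k.+1%:R^-1 & psi (u - (psi d)^-1 *: d) <= 0]].
  apply: contrapT => nu; apply: ne; exists k.+1%:R^-1; first by rewrite invr_gt0.
  move=> d z zint dz d0; rewrite leNgt; apply/negP => ltd; apply: nu.
  have u1 : psi ((psi d)^-1 *: d) = 1.
    by rewrite (psiZ hpsi) ?invr_ge0 ?(ltW d0) // mulVf // gt_eqF.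
  have [l l0 ul] := hc ((psi d)^-1 *: d).
  exists ((psi d)^-1 *: d + l); split.
  - by rewrite u1 mulr1 in ul.
  - by rewrite (psi_shift hpsi).
  - exists d; split => //; first by move=> m; exact: almost_null_lattice dz.
    by rewrite addrC addKr.
have {hu}[u hu] := choice hu.
have ub k : `|u k| <= c by have [] := hu k.
have [v hv] := bounded_seq_cluster ub.
suff v0 : psi v <= 0.
  have [k _ kv] := hv (C^-1) ltac:(by rewrite invr_gt0) 0%N.
  have [_ u1 _] := hu k.
  suff : 1 < psi v + 1 by rewrite ltrDr => /lt_le_trans /(_ v0); rewrite ltxx.
  rewrite -{1}u1 -[u k](subrK v) addrC (le_lt_trans (psiD hpsi _ _)) //.
  rewrite ltrD2l (le_lt_trans (hC _)) //.
  by rewrite -(ltr_pM2l C0) mulfV ?gt_eqF in kv.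
apply: (psi_le0_of_almost_null_ray hpsi) => s s0.
apply: (almost_null_closed hpsi) => e e0.
have e20 : 0 < e / 2 by rewrite divr_gt0.
(* [s + 1] replaces [s] so that the division is legitimate when [s = 0]. *)
have Cs0 : 0 < C * (s + 1) by rewrite mulr_gt0 // ltr_wpDl.
have [k hk kv] := hv _ (divr_gt0 e20 Cs0) (Num.truncn (e / 2)^-1).
have [_ _ [d [dnull d0 ltd ud]]] := hu k.
have ke : k.+1%:R^-1 <= e / 2.
  rewrite -[leRHS]invrK lef_pV2 ?posrE ?invr_gt0 //.
  by apply: ltW; apply: lt_le_trans (truncnS_gt _) _; rewrite ler_nat.
(* The ray point [s *: v] is compared with the last multiple of [d] whose [psi]-length does not
   exceed [s]; the leftover costs at most [psi d], which is below [e / 2]. *)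
pose m := Num.truncn (s / psi d).
exists (m%:R *: d) => //.
have /andP[m1 m2] : m%:R <= s / psi d < m.+1%:R.
  by apply: truncn_itv; rewrite divr_ge0 // ltW.
rewrite ler_pdivlMr // in m1; rewrite ltr_pdivrMr // -natr1 mulrDl mul1r in m2.
have -> : s *: v - m%:R *: d = s *: (v - u k)
    + ((s - m%:R * psi d) *: ((psi d)^-1 *: d) + s *: (u k - (psi d)^-1 *: d)).
  have -> : m%:R *: d = (m%:R * psi d) *: ((psi d)^-1 *: d).
    by rewrite scalerA mulfK // gt_eqF.
  rewrite scalerBl !scalerBr [_ - _ + (s *: u k - _)]addrC.
  by rewrite !subrKA.
rewrite (le_lt_trans (psiD hpsi _ _)) // (splitr e) ltr_leD //.
  rewrite (psiZ hpsi) // (@le_lt_trans _ _ ((s + 1) * psi (v - u k))) //.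
    by rewrite ler_wpM2r ?(psi_ge0 hpsi) // lerDl.
  rewrite distrC ltr_pdivlMr // in kv.
  apply: le_lt_trans kv; rewrite mulrC mulrCA mulrA.
  by rewrite ler_wpM2r ?addr_ge0.
rewrite (le_trans (psiD hpsi _ _)) // -[leRHS]addr0 lerD //.
  rewrite (psiZ hpsi) ?subr_ge0 // (psiZ hpsi) ?invr_ge0 ?(ltW d0) //.
  rewrite mulVf ?gt_eqF // mulr1; apply: le_trans ke; apply: le_trans (ltW ltd).
  lra.
by rewrite (psiZ hpsi) // mulr_ge0_le0.
Qed.

(** Without a minimum, translates [r + w k] with strictly decreasing values exist. Coercivity bounds
    their representatives modulo the null space, so two of these are close; their difference has
    positive value below the gap [e], yet is a lattice vector modulo the null space. *)
Lemma psi_min_translate r : exists2 w, integer_points w &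
  forall z, integer_points z -> psi (r + w) <= psi (r + z).
Proof.
have [C C0 hC] := psi_norm_bound hpsi.
have [c c0 hc] := psi_coercive hpsi.
have [e e0 he] := psi_lattice_gap.
apply: contrapT => nw.
have hg w : exists z, integer_points w ->
    integer_points z /\ psi (r + z) < psi (r + w).
  apply: contrapT => nz; apply: nw; exists w.
    by apply: contrapT => nwint; apply: nz; exists 0.
  move=> z zint; rewrite leNgt; apply/negP => ltz.
  by apply: nz; exists z.
have {hg}[g hg] := choice hg.
pose w k := iter k g 0.
have wint k : integer_points (w k).
  by elim: k => [|k /hg[]//]; exact: integer_points0.
have wdec j k : (j < k)%N -> psi (r + w k) < psi (r + w j).
  elim: k => // k IH; rewrite ltnS leq_eqVlt => /predU1P[->|/IH]; last first.
    by apply: lt_trans; have [] := hg _ (wint k).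
  by have [] := hg _ (wint k).
have hl k : exists l, psi l <= 0 /\ `|r + w k + l| <= c * psi (r + w k).
  by have [l] := hc (r + w k); exists l.
have {hl}[l hl] := choice hl.
pose x k := r + w k + l k.
have xb k : `|x k| <= c * psi (r + w 0%N).
  have [_ lek] := hl k; rewrite (le_trans lek) // ler_wpM2l ?(ltW c0) //.
  by case: k {lek} => [//|k]; rewrite ltW // wdec.
have [v hv] := bounded_seq_cluster xb.
have eC0 : 0 < e / C / 2 by rewrite !divr_gt0.
have [j _ jv] := hv _ eC0 0%N; have [k jk kv] := hv _ eC0 j.+1.
have xE i : psi (x i) = psi (r + w i) by exact: (psi_shift hpsi _ (hl i).1).
have : psi (x j - x k) < e.
  rewrite (le_lt_trans (hC _)) // mulrC -ltr_pdivlMr // [ltRHS]splitr.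
  rewrite -(subrKA v) (le_lt_trans (ler_normD _ _)) // ltrD //.
  by rewrite distrC.
apply/negP; rewrite -leNgt; apply: (he _ (w j - w k)).
- by apply: integer_pointsD => //; exact: integer_pointsN.
- have -> : x j - x k - (w j - w k) = l j - l k.
    have xw i : x i - w i = r + l i by rewrite /x addrAC addrK.
    rewrite opprB [w k - w j]addrC addrACA [- x k + _]addrC -[w k - x k]opprB.
    by rewrite !xw opprD addrACA subrr add0r.
  have [lj _] := hl j; have [lk _] := hl k.
  by have := psiD hpsi (l j) (- l k); have := psi_opp_le0 hpsi lk; lra.
- rewrite (lt_le_trans _ (psi_sub hpsi _ _)) // !xE subr_gt0; exact: wdec.
Qed.

End Attainment.

(** * Existence and periodicity of minimal liftings *)

Section MinimalLiftings.
Variables (R : realType) (n : nat) (f : 'rV[R]_n) (psi : 'rV[R]_n -> R).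
Hypothesis hpsi : minimal_continuous f psi.
Implicit Types (pi : 'rV[R]_n -> R) (r w : 'rV[R]_n).

(** Combinations with no integer part show that any [psi'] in a valid pair is valid for the
    continuous model, so minimality of [psi] leaves only [pi] to be compared. *)
Lemma minimal_liftingP pi :
  minimal_lifting f psi pi <->
  lifting f psi pi /\
  forall pi', lifting f psi pi' -> (forall r, pi' r <= pi r) -> pi' = pi.
Proof.
split=> [[hpi [_ hmin]]|[hpi hmin]].
  by split=> // pi' hpi' /(hmin psi pi' hpi' (fun=> lexx _)) [].
split=> //; split=> // psi' pi' hv le_psi le_pi.
suff psiE : psi' = psi by split=> //; apply: hmin => //; rewrite -psiE.
apply: hpsi.2 => //; apply/valid_continuousP => l l0 lint.
have := (valid_mixedP f psi' pi').1 hv l [::] l0.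
by rewrite !big_nil !addr0; apply.
Qed.

Lemma psi_lifting : lifting f psi psi.
Proof.
apply/(liftingP hpsi) => m w wint; apply: le_trans (psi_ge1 hpsi wint) _.
rewrite -{1}[w - f](subrK (\sum_(r <- m) r)) (le_trans (psiD hpsi _ _)) //.
by rewrite lerD2l (psi_sum hpsi).
Qed.

Lemma lifting_ge pi r : lifting f psi pi -> 1 - psi (- f - r) <= pi r.
Proof.
move=> /(liftingP hpsi) /(_ [:: r] 0 (@integer_points0 _ _)).
by rewrite !big_seq1 sub0r lerBlDl.
Qed.

(** Zorn's lemma for the reversed pointwise order. The pointwise infimum of a chain is finite by
    [lifting_ge], and is again a lifting because each inequality involves only finitely many
    values. *)
Lemma exists_minimal_lifting pi0 : lifting f psi pi0 ->
  exists2 pi, minimal_lifting f psi pi & forall r, pi r <= pi0 r.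
Proof.
move=> h0.
pose T := {q | lifting f psi q /\ forall r, q r <= pi0 r}.
pose rel (p q : T) := `[< forall r, sval q r <= sval p r >].
have [||||[pi [hpi le0]] hmax] := @Zorn T rel.
- by move=> p; apply/asboolP.
- by move=> p q s /asboolP pq /asboolP qs; apply/asboolP => r; exact: le_trans (qs r) (pq r).
- move=> [p hp] [q hq] /asboolP /= pq /asboolP /= qp.
  apply: eq_exist; apply/funext => r; apply/eqP; rewrite eq_le.
  by rewrite pq qp.
- move=> A Atot.
  have [[a0 Aa0]|A0] := pselect (exists a, A a); last first.
    exists (exist _ pi0 (conj h0 (fun=> lexx _))) => a Aa.
    by case: A0; exists a.
  pose E r := [set sval a r | a in A].
  pose g r := inf (E r).
  have Einf r : has_inf (E r).
    split; first by exists (sval a0 r), a0.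
    by exists (1 - psi (- f - r)) => _ [[a [ha ?]] _ <-]; exact: lifting_ge.
  have gle a r : A a -> g r <= sval a r.
    by move=> Aa; apply: ge_inf; [exact: (Einf r).2 | exists a].
  (* Totality of the chain yields one member that is close to the infimum at all points of [m] at
     once. *)
  have gapprox (m : seq 'rV[R]_n) e : 0 < e -> exists2 a, A a &
      forall r, r \in m -> sval a r <= g r + e.
    move=> e0; elim: m => [|r m [a Aa am]]; first by exists a0.
    have [_ [b Ab <-] blt] := inf_adherent e0 (Einf r).
    have [/asboolP ab|/asboolP ba] := Atot a b Aa Ab.
      exists b => // s; rewrite inE => /predU1P[->|/am]; first exact: ltW.
      exact: le_trans.
    exists a => // s; rewrite inE => /predU1P[->|/am //].
    exact: le_trans (ba r) (ltW blt).
  have glift : lifting f psi g.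
    apply/(liftingP hpsi) => m w wint; apply/ler_addgt0Pr => e e0.
    have m0 : 0 < (size m).+1%:R :> R by [].
    have [a Aa am] := gapprox m _ (divr_gt0 e0 m0).
    have [ha _] := svalP a.
    apply: le_trans ((liftingP hpsi (sval a)).1 ha m w wint) _.
    rewrite -[leRHS]addrA lerD2l.
    apply: (@le_trans _ _ (\sum_(r <- m) (g r + e / (size m).+1%:R))).
      by rewrite big_seq [leRHS]big_seq; apply: ler_sum => r /am.
    rewrite big_split /= lerD2l big_const_seq count_predT iter_addr_0.
    rewrite -[leLHS]mulr_natr -mulrA ger_pMr // mulrC ler_pdivrMr // mul1r.
    by rewrite ler_nat.
  have gle0 r : g r <= pi0 r.
    by apply: le_trans (gle a0 r Aa0) _; have [] := svalP a0.
  exists (exist _ g (conj glift gle0)) => a Aa; apply/asboolP => r /=.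
  exact: gle.
exists pi => //; apply/minimal_liftingP; split=> // pi' hpi' le_pi.
have le0' r : pi' r <= pi0 r := le_trans (le_pi r) (le0 r).
pose p' : T := exist _ pi' (conj hpi' le0').
exact: (congr1 sval (hmax p' (introT (asboolP _) le_pi))).
Qed.

(** If [pi (q + z) < pi q], lowering the value at [q] to [pi (q + z)] still gives a lifting:
    exchanging [q] for [q + z] only moves the lattice point reached. *)
Lemma minimal_lifting_periodic pi r w : minimal_lifting f psi pi ->
  integer_points w -> pi (r + w) = pi r.
Proof.
move=> /minimal_liftingP[/(liftingP hpsi) hpi hmin].
have le_pi q z : integer_points z -> pi q <= pi (q + z).
  move=> zint; rewrite leNgt; apply/negP => lt_pi.
  pose pi' s := if s == q then pi (q + z) else pi s.
  suff hpi' : lifting f psi pi'.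
    have pi'_le s : pi' s <= pi s by rewrite /pi'; case: eqP => // ->; exact: ltW.
    have /(congr1 (fun h => h q)) := hmin _ hpi' pi'_le.
    by rewrite /pi' eqxx => piE; rewrite piE ltxx in lt_pi.
  apply/(liftingP hpsi) => m x xint.
  pose g s := if s == q then q + z else s.
  have gm : \sum_(s <- [seq g s | s <- m]) s =
      \sum_(s <- m) s + z *+ count_mem q m.
    have -> : z *+ count_mem q m = \sum_(s <- m | s == q) z.
      by rewrite big_const_seq iter_addr_0.
    rewrite big_map [X in _ + X]big_mkcond -big_split /=.
    by apply: eq_bigr => s _; rewrite /g; case: eqP => [->|]; rewrite ?addr0.
  have := hpi [seq g s | s <- m] (x + z *+ count_mem q m).
  have -> : x + z *+ count_mem q m - f - \sum_(s <- [seq g s | s <- m]) s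
     = x - f - \sum_(s <- m) s.
    by rewrite gm (addrAC x) opprD [- _ - _]addrC addrA addrK.
  rewrite big_map (eq_bigr pi') => [|s _]; last first.
    by rewrite /g /pi'; case: eqP.
  by apply; apply: integer_pointsD => //; exact: integer_pointsMn.
move=> wint; apply/eqP; rewrite eq_le le_pi // andbT.
by rewrite -{2}[r](addrK w) le_pi //; exact: integer_pointsN.
Qed.

End MinimalLiftings.

(** * A least lifting coincides with the periodization of [psi] *)

Section LeastLifting.
Variables (R : realType) (n : nat) (f : 'rV[R]_n) (psi : 'rV[R]_n -> R).
Hypothesis hpsi : minimal_continuous f psi.

(* [phi] is the periodization of [psi], i.e. the trivial fill-in lifting. *)
Variable phi : 'rV[R]_n -> R.
Hypothesis phi_attained :
  forall r, exists2 w, integer_points w & phi r = psi (r + w).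
Hypothesis phi_le : forall r w, integer_points w -> phi r <= psi (r + w).

Lemma phi_le_psi r : phi r <= psi r.
Proof. by have := phi_le r (@integer_points0 R n); rewrite addr0. Qed.

Lemma phi_periodic r w : integer_points w -> phi (r + w) = phi r.
Proof.
move=> wint; apply/eqP; rewrite eq_le; apply/andP; split.
  have [z zint ->] := phi_attained r; rewrite -[r](addrK w) -[_ - w + z]addrA.
  rewrite addrK.
  by apply: phi_le; apply: integer_pointsD => //; exact: integer_pointsN.
have [z zint ->] := phi_attained (r + w).
by rewrite -addrA; apply: phi_le; exact: integer_pointsD.
Qed.

Lemma phiD x y : phi (x + y) <= phi x + phi y.
Proof.
have [w wint ->] := phi_attained x; have [z zint ->] := phi_attained y.
apply: le_trans (psiD hpsi _ _); rewrite addrACA.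
by apply: phi_le; exact: integer_pointsD.
Qed.

Lemma phi_ge0 x : 0 <= phi x.
Proof. by have [w _ ->] := phi_attained x; exact: (psi_ge0 hpsi). Qed.

Lemma phi0 : phi 0 = 0.
Proof.
by apply/eqP; rewrite eq_le phi_ge0 andbT -(psi0 hpsi) phi_le_psi.
Qed.

Lemma phiMn x k : phi (x *+ k) <= phi x *+ k.
Proof.
elim: k => [|k IH]; first by rewrite !mulr0n phi0.
by rewrite !mulrS (le_trans (phiD _ _)) // lerD2l.
Qed.

Lemma phi_oppf_ge1 : 1 <= phi (- f).
Proof.
by have [w wint ->] := phi_attained (- f); rewrite addrC; exact: (psi_ge1 hpsi).
Qed.

(* Otherwise [psi] could be rescaled. *)
Lemma phi_oppf : phi (- f) = 1.
Proof.
apply/eqP; rewrite eq_le phi_oppf_ge1 andbT leNgt; apply/negP => c1.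
set c := phi (- f) in c1.
have c0 : 0 < c by exact: lt_trans c1.
have psif1 : 1 <= psi (- f) := le_trans phi_oppf_ge1 (phi_le_psi _).
suff hv : valid_continuous f (fun r => psi r / c).
  have le_psi r : psi r / c <= psi r.
    by rewrite ler_pdivrMr // ler_peMr ?(psi_ge0 hpsi) // ltW.
  have /(congr1 (fun h => h (- f))) := hpsi.2 _ hv le_psi.
  have : psi (- f) / c < psi (- f).
    by rewrite ltr_pdivrMr // ltr_pMr // (lt_le_trans _ psif1).
  by move=> + E; rewrite /= E ltxx.
apply/valid_continuousP => l l0 lint.
under eq_bigr do rewrite mulrA; rewrite -mulr_suml ler_pdivlMr // mul1r.
apply: le_trans (psi_conic hpsi l0); rewrite -[X in psi X](addKr f).
exact: phi_le.
Qed.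

Lemma phi_opp_eq0 x : phi x = 0 -> phi (- x) = 0.
Proof.
have [w wint ->] := phi_attained x => xw0.
apply/eqP; rewrite eq_le phi_ge0 andbT.
apply: le_trans (phi_le _ (integer_pointsN wint)) _.
by rewrite -opprD (psi_opp_le0 hpsi) // xw0.
Qed.

Variable pi : 'rV[R]_n -> R.
Hypothesis pi_lifting : lifting f psi pi.
Hypothesis pi_least : forall pi', lifting f psi pi' -> forall r, pi r <= pi' r.

(* The function equal to [a] at [r] and to [psi] elsewhere is a lifting. *)
Lemma pi_le_of_admissible r a :
  (forall k, 1 <= a *+ k + phi (- f - r *+ k)) -> pi r <= a.
Proof.
move=> ha; pose pi' q := if q == r then a else psi q.
suff /pi_least /(_ r) : lifting f psi pi' by rewrite /pi' eqxx.
apply/(liftingP hpsi) => m w wint.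
have := ha (count_mem r m).
have -> : a *+ count_mem r m = \sum_(q <- m | q == r) pi' q.
  rewrite (eq_bigr (fun=> a)) => [|q /eqP ->]; last by rewrite /pi' eqxx.
  by rewrite big_const_seq iter_addr_0.
have -> : r *+ count_mem r m = \sum_(q <- m | q == r) q.
  rewrite (eq_bigr (fun=> r)) => [|q /eqP -> //].
  by rewrite big_const_seq iter_addr_0.
move=> /le_trans; apply.
rewrite [X in _ <= _ + X](bigID (fun q => q == r)) /= [leRHS]addrCA lerD2l.
rewrite [X in _ <= _ + X](eq_bigr psi) => [|q /negPf]; last by rewrite /pi' => ->.
set A := \sum_(q <- m | q == r) q.
have -> : \sum_(q <- m) q = A + \sum_(q <- m | q != r) q.
  by rewrite (bigID (fun q => q == r)).
rewrite -!(big_filter m (fun q => q != r)).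
apply: (@le_trans _ _ (psi (- f - A + w))); first exact: phi_le.
apply: le_trans _ (lerD (lexx _) (psi_sum hpsi _ _)).
apply: le_trans _ (psiD hpsi _ _).
by rewrite opprD addrA subrK addrAC [- f + w]addrC.
Qed.

Lemma pi_admissible r k : 1 <= pi r *+ k + phi (- f - r *+ k).
Proof.
have [w wint ->] := phi_attained (- f - r *+ k).
have := (liftingP hpsi pi).1 pi_lifting (nseq k r) w wint.
by rewrite !big_nseq !iter_addr_0 addrC [w - f]addrC [- f + w - _]addrAC.
Qed.

Lemma pi_periodic r w : integer_points w -> pi (r + w) = pi r.
Proof.
move=> wint.
have per k : phi (- f - (r + w) *+ k) = phi (- f - r *+ k).
  rewrite mulrnDl opprD addrA; apply: phi_periodic.
  by apply: integer_pointsN; exact: integer_pointsMn.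
apply/eqP; rewrite eq_le; apply/andP; split; apply: pi_le_of_admissible => k.
  by rewrite per pi_admissible.
by rewrite -per pi_admissible.
Qed.

(** The value [phi r] is admissible at [r], by subadditivity and [phi (- f) >= 1]. *)
Lemma pi_le_phi r : pi r <= phi r.
Proof.
apply: pi_le_of_admissible => k; apply: le_trans phi_oppf_ge1 _.
rewrite -{1}[- f](subrK (r *+ k)) [leRHS]addrC.
by rewrite (le_trans (phiD _ _)) // lerD2l phiMn.
Qed.

Lemma piD x y : pi (x + y) <= pi x + pi y.
Proof.
apply: pi_le_of_admissible => k.
have [w wint ->] := phi_attained (- f - (x + y) *+ k).
have := (liftingP hpsi pi).1 pi_lifting (nseq k x ++ nseq k y) w wint.
rewrite !big_cat /= !big_nseq !iter_addr_0 -!mulrnDl [psi _ + _]addrC.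
by rewrite [w - f]addrC [- f + w - _]addrAC.
Qed.

Lemma pi_sum_ge1 r : 1 <= pi r + pi (- f - r).
Proof.
have := (liftingP hpsi pi).1 pi_lifting [:: r; - f - r] 0 (@integer_points0 _ _).
rewrite !big_cons !big_nil !addr0 sub0r addrC [r + _]addrC subrK subrr.
by rewrite (psi0 hpsi) addr0.
Qed.

(** Otherwise [pi r] could be lowered by some [d <= pi r / 2]. For [k] beyond [2 / pi r] half of
    [pi r] already suffices, and the finitely many other [k >= 1] have positive slack. *)
Lemma pi_tight r : 0 < pi r ->
  exists2 k, (0 < k)%N & pi r *+ k + phi (- f - r *+ k) = 1.
Proof.
move=> r0; apply: contrapT => nt.
have gt1 k : (0 < k)%N -> 1 < pi r *+ k + phi (- f - r *+ k).
  move=> k0; rewrite lt_neqAle pi_admissible andbT.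
  by apply/eqP => kE; apply: nt; exists k.
have [d [d0 d2 hd]] : exists d, [/\ 0 < d, d <= pi r / 2 &
    forall k, (k <= (Num.truncn (2 / pi r)).+1)%N ->
      1 <= (pi r - d) *+ k + phi (- f - r *+ k)].
  elim: (Num.truncn _).+1 => [|K [d [d0 d2 hd]]].
    exists (pi r / 2); split; rewrite ?divr_gt0 //.
    by move=> k; rewrite leqn0 => /eqP ->; rewrite !mulr0n subr0 add0r phi_oppf_ge1.
  pose g := pi r *+ K.+1 + phi (- f - r *+ K.+1) - 1.
  have g0 : 0 < g by rewrite subr_gt0; exact: gt1.
  exists (Num.min d (g / K.+1%:R)); split.
  - by rewrite lt_min d0 divr_gt0.
  - by rewrite ge_min d2.
  - move=> k; rewrite leq_eqVlt ltnS => /predU1P[->|/hd hk]; last first.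
      apply: le_trans hk _; rewrite lerD2r lerMn2r lerD2l lerN2 ge_min lexx.
      by rewrite orbT.
    rewrite mulrnBl -lerBlDr -subr_ge0.
    have : Num.min d (g / K.+1%:R) *+ K.+1 <= g.
      rewrite -[leLHS]mulr_natr -ler_pdivlMr // ge_min lexx orbT //.
    by rewrite {2}/g; lra.
suff : pi r <= pi r - d by lra.
apply: pi_le_of_admissible => k.
have [/hd //|kK] := leqP k (Num.truncn (2 / pi r)).+1.
apply: (@le_trans _ _ ((pi r - d) *+ k)); last by rewrite lerDl phi_ge0.
apply: (@le_trans _ _ ((pi r / 2) *+ k)); last first.
  by rewrite lerMn2r; apply/orP; right; lra.
rewrite -[leRHS]mulr_natr -ler_pdivrMl ?divr_gt0 // mulr1 invf_div.
apply: le_trans (ltW (truncnS_gt _)) _; rewrite ler_nat; exact: ltnW.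
Qed.

(* When [pi] agrees with [phi] at the reflected point and is tight there,
   subadditivity carries the equality over to [r]. *)
Lemma phi_le_pi_of_reflection r k : (0 < k)%N ->
  phi (- f - r) <= pi (- f - r) ->
  pi (- f - r) *+ k + phi (- f - (- f - r) *+ k) = 1 -> phi r <= pi r.
Proof.
case: k => // k _ hphi hk; have := pi_sum_ge1 r; set p := - f - r in hphi hk *.
have : phi r <= phi (- f - p *+ k.+1) + phi p *+ k.
  have {1}-> : r = - f - p *+ k.+1 + p *+ k.
    by rewrite mulrS opprD addrA subrK /p opprB addrC subrK.
  by rewrite (le_trans (phiD _ _)) // lerD2l phiMn.
have : phi p *+ k <= pi p *+ k by rewrite lerMn2r hphi orbT.
by move: hk; rewrite mulrS; lra.
Qed.

Lemma phi_le_pi_or_half r : phi r <= pi r \/ phi (f + r *+ 2) = 0.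
Proof.
have sum1 := pi_sum_ge1 r; set p := - f - r in sum1 *.
have pE : - f - p = r by rewrite /p opprB addrC subrK.
(* Tightness with multiplicity one bounds [phi] at the reflected point; multiplicity at least two
   forces [pi q <= 1 / 2], as [le_half] shows. *)
have tight q : 0 < pi q -> phi (- f - q) <= 1 - pi q \/
    exists2 k, (1 < k)%N & pi q *+ k + phi (- f - q *+ k) = 1.
  move=> /pi_tight[[//|[|k]] _ kE]; last by right; exists k.+2.
  by left; move: kE; rewrite !mulr1n; lra.
have le_half q k : (1 < k)%N -> pi q *+ k + phi (- f - q *+ k) = 1 ->
    pi q <= 1 / 2.
  case: k => [|[|k]] // _ kE; rewrite !mulrS in kE.
  have h0 := phi_ge0 (- f - (q + (q + q *+ k))).
  have [q0|q0] := leP 0 (pi q); last by lra.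
  have qk0 : 0 <= pi q *+ k by rewrite mulrn_wge0.
  by lra.
have [r0|r0] := ltP 0 (pi r); last first.
  left; have [//||[k k1 kE]] := tight p _; first by lra.
    by rewrite pE; lra.
  by have := le_half _ _ k1 kE; lra.
have [p0|p0] := ltP 0 (pi p); last first.
  left; have [||[k k1 kE]] := tight r _ => //.
    rewrite -/p => p1.
    have phip : phi p = 0 by have := phi_ge0 p; lra.
    have -> : r = - f + - p by rewrite pE.
    apply: le_trans (phiD _ _) _; rewrite phi_oppf phi_opp_eq0 // addr0.
    by rewrite pE; lra.
  by have := le_half _ _ k1 kE; lra.
have [pp|[k k1 kE]] := tight p p0; first by left; move: pp; rewrite pE; lra.
have [rr|[j j1 jE]] := tight r r0.
  left; apply: (@phi_le_pi_of_reflection r k); first exact: ltnW.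
    by move: rr; rewrite -/p; lra.
  by rewrite -/p.
(* Both values are at most 1/2 and their sum is at least 1, so both equal 1/2; then [j >= 3] would
   already give at least 3/2. *)
right; have pk := le_half _ _ k1 kE; have rj := le_half _ _ j1 jE.
have piE : pi r = 1 / 2 by lra.
case: j j1 jE => [|[|[|j]]] // _; last first.
  rewrite !mulrS piE => jE; have := phi_ge0 (- f - (r + (r + (r + r *+ j)))).
  have : 0 <= (1 / 2 : R) *+ j by rewrite mulrn_wge0 // divr_ge0.
  by lra.
rewrite mulr2n piE => jE; rewrite -[f + _]opprK opprD phi_opp_eq0 //.
by lra.
Qed.

(* In the remaining case perturb [r] by a small multiple of [f]: if the
   half-integral case occurred on a neighbourhood of [r], then
   [phi (- f / k) = 0] for some [k], against [phi (- f) = 1]. *)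
Lemma phi_le_pi r : phi r <= pi r.
Proof.
rewrite leNgt; apply/negP => lt_r.
have r0 : phi (f + r *+ 2) = 0.
  by have [|//] := phi_le_pi_or_half r; rewrite leNgt lt_r.
pose gap := phi r - pi r; have gap0 : 0 < gap by rewrite subr_gt0.
(* [k] is so large that moving by [d = - f / (2 k)] changes [phi] and [pi] too little to close the
   gap, which leaves the half-integral case at [r + d]. *)
pose k := (Num.truncn ((psi f + psi (- f)) / gap)).+1.
have kgap : (psi f + psi (- f)) / k%:R < gap.
  rewrite ltr_pdivrMr // mulrC -ltr_pdivrMr //; exact: truncnS_gt.
have k0 : 0 < k%:R^-1 :> R by rewrite invr_gt0.
pose d := (k%:R^-1 / 2) *: (- f).
have kf s : psi ((k%:R^-1 / 2) *: s) = psi s / k%:R / 2.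
  by rewrite (psiZ hpsi) ?divr_ge0 ?ltW // mulrC mulrA.
have [le_rd|rd0] := phi_le_pi_or_half (r + d).
  have h1 : phi r <= phi (r + d) + psi f / k%:R / 2.
    rewrite -{1}[r](addrK d) (le_trans (phiD _ _)) // lerD2l.
    by rewrite /d -scalerN opprK -kf phi_le_psi.
  have h2 : pi (r + d) <= pi r + psi (- f) / k%:R / 2.
    rewrite (le_trans (piD _ _)) // lerD2l -kf.
    exact: le_trans (pi_le_phi _) (phi_le_psi _).
  have h3 := divr_ge0 (psi_ge0 hpsi f) (ler0n R k).
  have h4 := divr_ge0 (psi_ge0 hpsi (- f)) (ler0n R k).
  move: kgap; rewrite mulrDl /gap; lra.
have dE : d *+ 2 = k%:R^-1 *: - f.
  by rewrite -scaler_nat scalerA mulrC divfK // pnatr_eq0.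
(* [2 d = - f / k] is the difference of two zeros of [phi]. *)
have d0 : phi (d *+ 2) <= 0.
  have -> : d *+ 2 = (f + (r + d) *+ 2) - (f + r *+ 2).
    by rewrite mulrnDl addrA [RHS]addrC addKr.
  by rewrite (le_trans (phiD _ _)) // rd0 add0r phi_opp_eq0.
have : phi (- f) <= 0.
  have -> : - f = (d *+ 2) *+ k.
    by rewrite dE -scaler_nat scalerA mulfV ?scale1r // pnatr_eq0.
  by rewrite (le_trans (phiMn _ _)) // mulrn_wle0.
by rewrite phi_oppf ler10.
Qed.

End LeastLifting.

(** * Uniqueness of the minimal lifting against covering by translates of [R_set] *)

Theorem theorem5 (R : realType) (n : nat) (f : 'rV[R]_n)
    (hf : ~ integer_points f) (psi : 'rV[R]_n -> R)
    (hpsi : minimal_continuous f psi) :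
  (exists! pi : 'rV[R]_n -> R, minimal_lifting f psi pi) <->
  minkowski_sum (R_set f psi) (@integer_points R n) = [set: 'rV[R]_n].
Proof.
split=> [[pi [hpi pi_uniq]]|hR]; last first.
  have [pi hpi _] := exists_minimal_lifting hpsi (psi_lifting hpsi).
  exists pi; split=> // pi' hpi'; apply/funext => r.
  have : minkowski_sum (R_set f psi) (@integer_points R n) r by rewrite hR.
  case=> q hq [w wint <-].
  rewrite (minimal_lifting_periodic hpsi q hpi wint).
  by rewrite (minimal_lifting_periodic hpsi q hpi' wint) hq // hq.
have [pi_lift _] := hpi.
(* Some minimal lifting lies below [pi'], and by uniqueness it is [pi]. *)
have pi_least pi' : lifting f psi pi' -> forall r, pi r <= pi' r.
  move=> /(exists_minimal_lifting hpsi)[q hq le_q] r.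
  by rewrite (pi_uniq _ hq).
have hw r : exists w, integer_points w /\
    forall z, integer_points z -> psi (r + w) <= psi (r + z).
  by have [w] := psi_min_translate hpsi r; exists w.
have {hw}[w hw] := choice hw.
pose phi r := psi (r + w r).
have phi_attained r : exists2 z, integer_points z & phi r = psi (r + z).
  by exists (w r) => //; have [] := hw r.
have phi_le r z : integer_points z -> phi r <= psi (r + z).
  by have [_] := hw r; apply.
(* The minimizing translate [r + w r] lies in [R_set]: there [pi] equals [pi r = phi r], which is
   [psi (r + w r)]. *)
apply/seteqP; split=> // r _; exists (r + w r); last first.
  by exists (- w r); [apply: integer_pointsN; have [] := hw r | rewrite addrK].
move=> pi' /pi_uniq <-; have [wint _] := hw r.
rewrite (pi_periodic hpsi phi_attained phi_le pi_lift pi_least r wint).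
apply/eqP; rewrite eq_le (pi_le_phi hpsi phi_attained phi_le pi_least r).
exact: (phi_le_pi hpsi phi_attained phi_le pi_lift pi_least r).
Qed.
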